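(* Let $\Lambda$ be an artin algebra, $\mathcal{C}$ an extension-closed full subcategory of $\Lambda\text{-mod}$ and $n\ge 1$. There is a one-to-one correspondence between the set of $n$-torsion pair series on $\mathcal{C}$ and the set of $n$-torsion pairs on $\mathcal{C}$, given by the mutually inverse maps $\alpha$ (from series to $n$-torsion pairs) and $\beta$ (from $n$-torsion pairs to series): $$\alpha\big(\{(\mathcal{T}_1,\mathcal{F}_1),\dots,(\mathcal{T}_n,\mathcal{F}_n)\}\big)=(\mathcal{T}_1,\ \mathcal{F}_1\cap\mathcal{T}_2,\ \dots,\ \mathcal{F}_{n-1}\cap\mathcal{T}_n,\ \mathcal{F}_n),$$ $$\beta\big((\mathcal{C}_1,\dots,\mathcal{C}_{n+1})\big)=\{(\langle \mathcal{C}_1,\dots,\mathcal{C}_i\rangle,\ \langle \mathcal{C}_{i+1},\dots,\mathcal{C}_{n+1}\rangle)\mid i=1,\dots,n\}.$$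
   Context: $\Lambda\text{-mod}$ is the category of finitely generated left $\Lambda$-modules. Subcategories are closed under isomorphism; as usual, extension-closed subcategories contain $0$. For full subcategories $\mathcal{C}_1,\dots,\mathcal{C}_r$ of $\Lambda\text{-mod}$, $\langle\mathcal{C}_1,\dots,\mathcal{C}_r\rangle$ is the smallest full extension-closed subcategory containing them (for an empty list it is $\{0\}$). For a subcategory $\mathcal{D}$, ${}^\bot\mathcal{D}=\{M\mid \mathrm{Hom}(M,N)=0\ \forall N\in\mathcal{D}\}$ and $\mathcal{D}^\bot=\{N\mid \mathrm{Hom}(M,N)=0\ \forall M\in\mathcal{D}\}$. A torsion pair on $\mathcal{C}$ is a pair $(\mathcal{T},\mathcal{F})$ of full subcategories of $\mathcal{C}$ such that $\mathrm{Hom}(X,Y)=0$ for all $X\in\mathcal{T},Y\in\mathcal{F}$, and every $X\in\mathcal{C}$ admits an exact sequence $0\to X_{\mathcal{T}}\to X\to X_{\mathcal{F}}\to 0$ in $\Lambda\text{-mod}$ with $X_{\mathcal{T}}\in\mathcal{T}$, $X_{\mathcal{F}}\in\mathcal{F}$. An $n$-torsion pair on $\mathcal{C}$ is an $(n+1)$-tuple $(\mathcal{C}_1,\dots,\mathcal{C}_{n+1})$ of full extension-closed subcategories of $\mathcal{C}$ such that for $i=1,\dots,n+1$: (1) $\mathcal{C}_i=\mathcal{C}\cap\langle\mathcal{C}_1,\dots,\mathcal{C}_{i-1}\rangle^\bot\cap{}^\bot\langle\mathcal{C}_{i+1},\dots,\mathcal{C}_{n+1}\rangle$; (2) $(\langle\mathcal{C}_1,\dots,\mathcal{C}_i\rangle,\langle\mathcal{C}_{i+1},\dots,\mathcal{C}_{n+1}\rangle)$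 is a torsion pair on $\mathcal{C}$. An $n$-torsion pair series on $\mathcal{C}$ is a sequence $\{(\mathcal{T}_1,\mathcal{F}_1),\dots,(\mathcal{T}_n,\mathcal{F}_n)\}$ of torsion pairs on $\mathcal{C}$ with $\mathcal{T}_1\subseteq\mathcal{T}_2\subseteq\dots\subseteq\mathcal{T}_n$ (equivalently $\mathcal{F}_1\supseteq\dots\supseteq\mathcal{F}_n$). *)

(* Defs.v *)
From mathcomp Require Import all_boot all_order all_algebra.

Set Implicit Arguments.
Unset Strict Implicit.
Unset Printing Implicit Defensive.

Import GRing.Theory.
Local Open Scope ring_scope.

Definition is_ideal (k : comPzRingType) (I : k -> Prop) : Prop :=
  [/\ I 0, forall x y, I x -> I y -> I (x + y) & forall a x, I x -> I (a * x)].

Definition artinian (k : comPzRingType) : Prop :=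
  forall I : nat -> k -> Prop,
    (forall m, is_ideal (I m)) -> (forall m x, I m.+1 x -> I m x) ->
  exists N, forall m, (N <= m)%N -> forall x, I m x <-> I N x.

(* The algebra structure is given by a central ring morphism from the base
   ring, rather than by algType, because algType excludes the zero ring. *)
Definition artin_algebra (L : pzRingType) : Prop :=
  exists (k : comPzRingType) (phi : {rmorphism k -> L}),
    [/\ artinian k,
        forall a x, phi a * x = x * phi a
      & exists (m : nat) (v : 'I_m -> L),
          forall x, exists c : 'I_m -> k, x = \sum_(i < m) phi (c i) * v i].

(* A full subcategory of L-mod is represented by its class of objects. This is
   not [set (lmodType L)] of mathcomp-classical: the universe of [set] lies
   strictly below that of [lmodType L]. *)
Definition modclass (L : pzRingType) := lmodType L -> Prop.

Section Subcategories.
Variable L : pzRingType.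
Implicit Types C D E T F : modclass L.

Definition subclass D E : Prop := forall M, D M -> E M.

Definition interclass D E : modclass L := fun M => D M /\ E M.

(* The objects of L-mod. *)
Definition fgmod : modclass L :=
  fun M => exists (m : nat) (v : 'I_m -> M),
             forall x, exists c : 'I_m -> L, x = \sum_(i < m) c i *: v i.

Definition full_subcategory D : Prop :=
  subclass D fgmod /\
  forall (M N : lmodType L) (f : {linear M -> N}), bijective f -> D M -> D N.

Definition short_exact (X Y Z : lmodType L)
    (f : {linear X -> Y}) (g : {linear Y -> Z}) : Prop :=
  [/\ injective f,
      forall y, g y = 0 <-> exists x, f x = y
    & forall z, exists y, g y = z].

Definition extension_closed D : Prop :=
  [/\ full_subcategory D,
      forall Z : lmodType L, (forall z : Z, z = 0) -> D Z
    & forall (X Y Z : lmodType L) (f : {linear X -> Y}) (g : {linear Y -> Z}),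
        fgmod Y -> short_exact f g -> D X -> D Z -> D Y].

(* <C_i | i satisfying P>, the smallest full extension-closed subcategory
   containing these C_i, as an intersection. *)
Definition ext_span (I : Type) (P : I -> Prop) (c : I -> modclass L) :
    modclass L :=
  fun M => forall D, extension_closed D -> (forall i, P i -> subclass (c i) D) ->
           D M.

Definition hom_zero (M N : lmodType L) : Prop :=
  forall (f : {linear M -> N}) x, f x = 0.

Definition lperp D : modclass L :=
  fun M => fgmod M /\ forall N, D N -> hom_zero M N.

Definition rperp D : modclass L :=
  fun N => fgmod N /\ forall M, D M -> hom_zero M N.

Definition torsion_pair C (p : modclass L * modclass L) : Prop :=
  let: (T, F) := p in
  [/\ full_subcategory T /\ subclass T C,
      full_subcategory F /\ subclass F C,
      forall X Y, T X -> F Y -> hom_zero X Y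
    & forall X, C X ->
        exists (XT XF : lmodType L)
               (f : {linear XT -> X}) (g : {linear X -> XF}),
          [/\ short_exact f g, T XT & F XF]].

(* Indices are shifted by one: the tuple (C_1, ..., C_{n+1}) is c : 'I_n.+1 -> _
   with C_{j+1} = c j, and the series (T_1, F_1), ..., (T_n, F_n) is
   s : 'I_n -> _ with (T_{i+1}, F_{i+1}) = s i. *)
Definition n_torsion_pair C (n : nat) (c : 'I_n.+1 -> modclass L) : Prop :=
  forall j : 'I_n.+1,
    [/\ extension_closed (c j) /\ subclass (c j) C,
        c j = interclass C
                (interclass (rperp (ext_span (fun k : 'I_n.+1 => k < j)%N c))
                            (lperp (ext_span (fun k : 'I_n.+1 => j < k)%N c)))
      & torsion_pair C (ext_span (fun k : 'I_n.+1 => k <= j)%N c,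
                        ext_span (fun k : 'I_n.+1 => j < k)%N c)].

Definition torsion_pair_series C (n : nat)
    (s : 'I_n -> modclass L * modclass L) : Prop :=
  (forall i, torsion_pair C (s i)) /\
  (forall i j : 'I_n, (i <= j)%N -> subclass (s i).1 (s j).1).

(* [unlift ord0 j] is j - 1 if 0 < j, and [unlift ord_max j] is j if j < n.
   The last case arises only for n = 0 and is a dummy value. *)
Definition alpha (n : nat) (s : 'I_n -> modclass L * modclass L) :
    'I_n.+1 -> modclass L :=
  fun j => match unlift ord0 j, unlift ord_max j with
           | None, Some i => (s i).1
           | Some h, Some i => interclass (s h).2 (s i).1
           | Some h, None => (s h).2
           | None, None => fun _ => False
           end.

Definition beta (n : nat) (c : 'I_n.+1 -> modclass L) :
    'I_n -> modclass L * modclass L :=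
  fun i => (ext_span (fun k : 'I_n.+1 => k <= i)%N c,
            ext_span (fun k : 'I_n.+1 => i < k)%N c).

End Subcategories.

(* Main.v *)
Require Import Defs.
From mathcomp Require Import all_boot all_order all_algebra.
From HB Require Import structures.
From Stdlib Require Import FunctionalExtensionality PropExtensionality.

(** Each half of a torsion pair on [C] is the orthogonal of the other one inside
    [C], hence is extension-closed.  Prolong a series by [(0, C)] at the beginning
    and by [(C, 0)] at the end: then all terms of its image under [alpha] are
    [F_j] intersected with [T_{j+1}], and filtering a module of [T_j]
    (resp. [F_j]) by the torsion submodules shows that [T_j] (resp. [F_j]) is the
    extension closure of the terms before (resp. after) position [j].  Hence
    [beta (alpha s) = s].  Condition (1) of an n-torsion pair recovers it from
    its extension closures, so [beta] is injective, and [alpha (beta c) = c]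
    follows. *)

Set Implicit Arguments.
Unset Strict Implicit.
Unset Printing Implicit Defensive.

Import GRing.Theory.
Local Open Scope ring_scope.

(** * Factoring linear maps, and vanishing of Hom along exact sequences *)

Section LinearMaps.
Variable L : pzRingType.
Implicit Types X Y Z : lmodType L.

Lemma linear_ex X Y (f : X -> Y) :
  linear f -> exists g : {linear X -> Y}, g =1 f.
Proof.
move=> lin_f; pose m := GRing.isLinear.Build L X Y *:%R f lin_f.
pose g : {linear X -> Y} := HB.pack f m.
by exists g.
Qed.

Lemma inj_surj_bijective X Y (f : {linear X -> Y}) :
  injective f -> (forall y, exists x, f x = y) -> bijective f.
Proof.
move=> inj_f surj_f.
(* [xchoose] needs a boolean predicate, hence [==]; the preimage is then picked by the choice
   structure of [X]. *)
have ex y : exists x, f x == y by have [x <-] := surj_f y; exists x.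
have fK y : f (xchoose (ex y)) = y by apply/eqP/(xchooseP (ex y)).
by exists (fun y => xchoose (ex y)) => // x; apply: inj_f; rewrite fK.
Qed.

(** By the kernel condition [h] is constant on the fibres of [g], so the value at a chosen preimage
    is independent of the choice, hence linear. *)
Lemma linear_factor_surj X Y Z (g : {linear X -> Y}) (h : {linear X -> Z}) :
  (forall y, exists x, g x = y) -> (forall x, g x = 0 -> h x = 0) ->
  exists k : {linear Y -> Z}, forall x, k (g x) = h x.
Proof.
move=> surj_g ker_g.
have ex y : exists x, g x == y by have [x <-] := surj_g y; exists x.
have gK y : g (xchoose (ex y)) = y by apply/eqP/(xchooseP (ex y)).
have h_eq x x' : g x = g x' -> h x = h x'.
  move=> e; apply/eqP; rewrite -subr_eq0 -linearB; apply/eqP/ker_g.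
  by rewrite linearB e subrr.
have [|k kE] := @linear_ex Y Z (fun y => h (xchoose (ex y))).
  by move=> a u v; rewrite -linearP; apply: h_eq; rewrite linearP !gK.
by exists k => x; rewrite kE; apply: h_eq; rewrite gK.
Qed.

Lemma linear_factor_inj X Y Z (f : {linear X -> Y}) (h : {linear Z -> Y}) :
  injective f -> (forall z, exists x, f x = h z) ->
  exists k : {linear Z -> X}, forall z, f (k z) = h z.
Proof.
move=> inj_f im_f.
have ex z : exists x, f x == h z by have [x <-] := im_f z; exists x.
have fK z : f (xchoose (ex z)) = h z by apply/eqP/(xchooseP (ex z)).
have [|k kE] := @linear_ex Z X (fun z => xchoose (ex z)).
  by move=> a u v; apply: inj_f; rewrite fK [LHS]linearP [RHS]linearP !fK.
by exists k => z; rewrite kE fK.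
Qed.

(** Factoring the identity of [X] through [g] inverts [g]. The map from [Y] to [X] is the one that
    transports membership from a torsion-free quotient back to the module. *)
Lemma surj_bijective_inv X Y (g : {linear X -> Y}) :
  (forall y, exists x, g x = y) -> (forall x, g x = 0 -> x = 0) ->
  exists k : {linear Y -> X}, bijective k.
Proof.
move=> surj_g ker_g.
have [//|k kK] := @linear_factor_surj X Y X g idfun surj_g.
by exists k, g => // y; have [x <-] := surj_g y; rewrite kK.
Qed.

(** A map out of [Y] that vanishes on the image of [X] factors through [Z]. *)
Lemma hom_zero_ext X Y Z M (f : {linear X -> Y}) (g : {linear Y -> Z}) :
  short_exact f g -> hom_zero X M -> hom_zero Z M -> hom_zero Y M.
Proof.
case=> _ ker_g surj_g XM ZM h y.
have [x /ker_g[x' <-]|k kE] := linear_factor_surj (h := h) surj_g.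
  exact: (XM (h \o f)).
by rewrite -kE ZM.
Qed.

(** A map into [Y] that dies in [Z] lifts to [X]. *)
Lemma ext_hom_zero X Y Z M (f : {linear X -> Y}) (g : {linear Y -> Z}) :
  short_exact f g -> hom_zero M X -> hom_zero M Z -> hom_zero M Y.
Proof.
case=> inj_f ker_g _ MX MZ h m.
have [z|k kE] := linear_factor_inj (h := h) inj_f.
  by apply/ker_g; exact: (MZ (g \o h)).
by rewrite -kE MX linear0.
Qed.

Lemma hom_zero_quotient X Y M (g : {linear X -> Y}) :
  (forall y, exists x, g x = y) -> hom_zero X M -> hom_zero Y M.
Proof. by move=> surj_g XM h y; have [x <-] := surj_g y; exact: (XM (h \o g)). Qed.

Lemma hom_zero_sub X Y M (f : {linear X -> Y}) :
  injective f -> hom_zero M Y -> hom_zero M X.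
Proof. by move=> inj_f MY h m; apply: inj_f; rewrite linear0; exact: (MY (f \o h)). Qed.

End LinearMaps.

(** * Module classes and torsion pairs on [C] *)

Section Classes.
Variable L : pzRingType.
Implicit Types C D E T F : modclass L.

Lemma modclass_eq D E : subclass D E -> subclass E D -> D = E.
Proof.
move=> DE ED; apply: functional_extensionality => M.
by apply: propositional_extensionality; split; [exact: DE | exact: ED].
Qed.

Lemma interclass_extension_closed D E :
  extension_closed D -> extension_closed E -> extension_closed (interclass D E).
Proof.
move=> [[D_fg D_iso] D0 D_ext] [[_ E_iso] E0 E_ext]; split.
- split=> [M [/D_fg]//|M N f bij_f [DM EM]].
  by split; [exact: D_iso bij_f DM | exact: E_iso bij_f EM].
- by move=> Z Z0; split; [exact: D0 | exact: E0].
- move=> X Y Z f g fgY sfg [DX EX] [DZ EZ].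
  by split; [exact: D_ext sfg DX DZ | exact: E_ext sfg EX EZ].
Qed.

Definition zeroclass : modclass L := fun M => forall x : M, x = 0.

Lemma zeroclass_extension_closed : extension_closed zeroclass.
Proof.
split=> //.
- split=> [M M0|M N f [g _ gK] M0 x].
    by exists 0%N, (fun=> 0) => x; exists (fun=> 0); rewrite big_ord0 (M0 x).
  by rewrite -[x]gK (M0 (g x)) linear0.
- move=> X Y Z f g _ [_ ker_g _] X0 Z0 y.
  by have /ker_g[x <-] := Z0 (g y); rewrite (X0 x) linear0.
Qed.

Lemma zeroclass_sub D : extension_closed D -> subclass zeroclass D.
Proof. by case=> _ D0 _ M M0; exact: D0. Qed.

Lemma zeroclass_inhabited : exists M : lmodType L, zeroclass M.
Proof. by exists 'rV[L]_0 => x; apply/matrixP => i []. Qed.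

Lemma torsion_pair_zero_full C :
  extension_closed C -> torsion_pair C (zeroclass, C).
Proof.
move=> hC; have [C_full _ _] := hC; have hZ := zeroclass_extension_closed.
split; [by split; [case: hZ | exact: zeroclass_sub] | by split | |].
  by move=> X Y X0 _ f x; rewrite (X0 x) linear0.
move=> X CX; have [O O0] := zeroclass_inhabited.
exists O, X, \0, idfun; split=> //; split=> [x y _|y|z]; last by exists z.
  by rewrite (O0 x) (O0 y).
by split=> [/= ->|[x <-]]; [exists 0|].
Qed.

Lemma torsion_pair_full_zero C :
  extension_closed C -> torsion_pair C (C, zeroclass).
Proof.
move=> hC; have [C_full _ _] := hC; have hZ := zeroclass_extension_closed.
split; [by split | by split; [case: hZ | exact: zeroclass_sub] | |].
  by move=> X Y _ Y0 f x; exact: Y0.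
move=> X CX; have [O O0] := zeroclass_inhabited.
exists X, O, idfun, \0; split=> //; split=> [x y //|y|z]; last first.
  by exists 0; rewrite (O0 z).
by split=> // _; exists y.
Qed.

(** If [X] in [C] has no nonzero map to [F], the quotient map of its torsion sequence is zero, so
    the torsion submodule is all of [X]. *)
Lemma torsion_classE C T F : extension_closed C -> torsion_pair C (T, F) ->
  T = interclass C (lperp F).
Proof.
move=> [[C_fg _] _ _] [[[_ T_iso] TC] _ TF ex]; apply: modclass_eq => X.
  by move=> TX; split; [exact: TC|split=> [|N FN]; [exact/C_fg/TC|exact: TF]].
case=> CX [_ X_perp]; have [A [B [f [g [[inj_f ker_g _] TA FB]]]]] := ex X CX.
apply: (T_iso A X f) => //; apply: inj_surj_bijective => // x.
by apply/ker_g; exact: X_perp.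
Qed.

(** Dually, the inclusion of the torsion submodule is zero, so [X] is isomorphic to its torsion-free
    quotient. *)
Lemma torsionfree_classE C T F : extension_closed C -> torsion_pair C (T, F) ->
  F = interclass C (rperp T).
Proof.
move=> [[C_fg _] _ _] [_ [[_ F_iso] FC] TF ex]; apply: modclass_eq => X.
  by move=> FX; split; [exact: FC|split=> [|N TN]; [exact/C_fg/FC|exact: TF]].
case=> CX [_ X_perp]; have [A [B [f [g [[_ ker_g surj_g] TA FB]]]]] := ex X CX.
have [|k bij_k] := surj_bijective_inv surj_g; last exact: (F_iso B X k).
by move=> x /ker_g[a <-]; exact: X_perp.
Qed.

Lemma torsion_class_extension_closed C T F :
  extension_closed C -> torsion_pair C (T, F) -> extension_closed T.
Proof.
move=> hC tp; have TE := torsion_classE hC tp; case: hC => _ C0 C_ext.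
case: tp => [[T_full TC] _ TF _]; split=> // [Z Z0|X Y Z f g fgY sfg TX TZ].
  rewrite TE; split; first exact: C0.
  split=> [|N _ h x]; last by rewrite (Z0 x) linear0.
  by case: zeroclass_extension_closed => -[+ _] _ _; exact.
rewrite TE; split; first by apply: C_ext sfg _ _ => //; exact: TC.
by split=> // N FN; apply: hom_zero_ext sfg _ _; exact: TF.
Qed.

Lemma torsionfree_class_extension_closed C T F :
  extension_closed C -> torsion_pair C (T, F) -> extension_closed F.
Proof.
move=> hC tp; have FE := torsionfree_classE hC tp; case: hC => _ C0 C_ext.
case: tp => [_ [F_full FC] TF _]; split=> // [Z Z0|X Y Z f g fgY sfg FX FZ].
  rewrite FE; split; first exact: C0.
  split=> [|N _ h x]; last exact: Z0.
  by case: zeroclass_extension_closed => -[+ _] _ _; exact.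
rewrite FE; split; first by apply: C_ext sfg _ _ => //; exact: FC.
by split=> // N TN; apply: ext_hom_zero sfg _ _; exact: TF.
Qed.

(** * Extension closures of families *)

Section ExtSpan.
Variable I : Type.
Implicit Types (P Q : I -> Prop) (c : I -> modclass L).

Lemma ext_span_mono P Q c :
  (forall i, P i -> Q i) -> subclass (ext_span P c) (ext_span Q c).
Proof. by move=> PQ M PM D hD QD; apply: PM => // i /PQ; exact: QD. Qed.

Lemma eq_ext_span P Q c c' : (forall i, P i <-> Q i) ->
  (forall i, P i -> c i = c' i) -> ext_span P c = ext_span Q c'.
Proof.
move=> PQ cc'; apply: modclass_eq => M h D hD hsub; apply: h => // i.
  by move=> Pi; rewrite cc' //; apply/hsub/PQ.
by move=> /PQ Pi; rewrite -cc' //; apply: hsub.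
Qed.

End ExtSpan.

(** * The prolonged series and its torsion sequences *)

Section Prolongation.
Variables (C : modclass L) (n : nat) (s : 'I_n -> modclass L * modclass L).

(* The series shifted by one and prolonged by [(0, C)] and [(C, 0)], so that
   the paper's [(T_k, F_k)] is [prolong k]. *)
Definition prolong (k : nat) : modclass L * modclass L :=
  if k is i.+1 then
    if insub i is Some i' then s i' else (C, zeroclass)
  else (zeroclass, C).

Lemma prolongS (i : 'I_n) : prolong i.+1 = s i.
Proof. by rewrite /prolong valK. Qed.

Lemma prolong_last : prolong n.+1 = (C, zeroclass).
Proof. by rewrite /prolong insubF ?ltnn. Qed.

Hypotheses (hC : extension_closed C) (hs : torsion_pair_series C s).

Lemma prolong_torsion_pair k : torsion_pair C ((prolong k).1, (prolong k).2).
Proof.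
case: k => [|i] /=; first exact: torsion_pair_zero_full.
case: insubP => [i' _ _|_]; last exact: torsion_pair_full_zero.
by have [+ _] := hs => /(_ i'); case: (s i').
Qed.

Lemma prolong_torsion_sub k : subclass (prolong k).1 C.
Proof. by case: (prolong_torsion_pair k) => -[]. Qed.

Lemma prolong_torsionfree_sub k : subclass (prolong k).2 C.
Proof. by case: (prolong_torsion_pair k) => _ []. Qed.

Lemma prolong_torsion_mono j k :
  (j <= k)%N -> subclass (prolong j).1 (prolong k).1.
Proof.
case: j => [_|j].
  exact: zeroclass_sub (torsion_class_extension_closed hC (prolong_torsion_pair k)).
case: k => // k; rewrite ltnS => le_jk; have tp := prolong_torsion_pair j.+1.
move: tp => /=; case: (insubP _ k) => [k' lt_kn k'E|_] [[_ TC] _ _ _]; last first.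
  (* Here [k] is at least [n], where the larger torsion class is [C] itself. *)
  exact: TC.
case: insubP => [j' _ j'E|]; last by rewrite (leq_ltn_trans le_jk lt_kn).
by apply: (proj2 hs); rewrite j'E k'E.
Qed.

Lemma prolong_torsionfree_anti j k :
  (j <= k)%N -> subclass (prolong k).2 (prolong j).2.
Proof.
move=> le_jk M FM; rewrite (torsionfree_classE hC (prolong_torsion_pair j)).
have := FM; rewrite (torsionfree_classE hC (prolong_torsion_pair k)).
move=> [CM [fgM M_perp]]; split=> //; split=> // N TN.
exact/M_perp/(prolong_torsion_mono le_jk).
Qed.

(** Take the torsion sequence of [X] for pair [j]: its quotient [B] is also a quotient of [X], so it
    has no nonzero map to the torsion-free class of pair [j.+1]. *)
Lemma prolong_torsion_step j X : (prolong j.+1).1 X ->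
  exists (A B : lmodType L) (f : {linear A -> X}) (g : {linear X -> B}),
    [/\ short_exact f g, (prolong j).1 A
      & interclass (prolong j).2 (prolong j.+1).1 B].
Proof.
move=> TX; have [_ _ _ ex] := prolong_torsion_pair j.
have [A [B [f [g [sfg TA FB]]]]] := ex X (prolong_torsion_sub TX).
exists A, B, f, g; split=> //; split=> //.
have [_ _ TF _] := prolong_torsion_pair j.+1.
have CB := prolong_torsionfree_sub FB.
rewrite (torsion_classE hC (prolong_torsion_pair j.+1)); split=> //.
split=> [|N FN]; first by case: hC => -[C_fg _] _ _; exact: C_fg.
by case: sfg => _ _ surj_g; apply: hom_zero_quotient surj_g _; exact: TF.
Qed.

(** Take the torsion sequence of [X] for pair [j.+1]: its submodule [A] embeds in [X], so it
    receives no nonzero map from the torsion class of pair [j]. *)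
Lemma prolong_torsionfree_step j X : (prolong j).2 X ->
  exists (A B : lmodType L) (f : {linear A -> X}) (g : {linear X -> B}),
    [/\ short_exact f g, interclass (prolong j).2 (prolong j.+1).1 A
      & (prolong j.+1).2 B].
Proof.
move=> FX; have [_ _ _ ex] := prolong_torsion_pair j.+1.
have [A [B [f [g [sfg TA FB]]]]] := ex X (prolong_torsionfree_sub FX).
exists A, B, f, g; split=> //; split=> //.
have [_ _ TF _] := prolong_torsion_pair j.
have CA := prolong_torsion_sub TA.
rewrite (torsionfree_classE hC (prolong_torsion_pair j)); split=> //.
split=> [|N TN]; first by case: hC => -[C_fg _] _ _; exact: C_fg.
by case: sfg => inj_f _ _; apply: hom_zero_sub inj_f _; exact: TF.
Qed.

(** * The terms of [alpha s] and their extension closures *)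

Hypothesis n_gt0 : (0 < n)%N.

Lemma alphaE (j : 'I_n.+1) :
  alpha s j = interclass (prolong j).2 (prolong j.+1).1.
Proof.
rewrite /alpha; case: unliftP => [h|] jE.
  have -> : prolong j = s h by rewrite jE lift0 prolongS.
  case: unliftP => [i|] jE'.
    by rewrite -(prolongS i) jE' lift_max.
  rewrite jE' prolong_last -(prolongS h).
  by apply: modclass_eq => [M FM|M []//]; split=> //; exact: prolong_torsionfree_sub FM.
case: unliftP => [i|] jE'.
  have -> : prolong j.+1 = s i by rewrite jE' lift_max prolongS.
  rewrite jE -(prolongS i).
  by apply: modclass_eq => [M TM|M []//]; split=> //; exact: prolong_torsion_sub TM.
(* Being both the first and the last index would force [n] to be zero. *)
by have := congr1 val jE'; rewrite jE /= => n0; have := n_gt0; rewrite -[X in (_ < X)%N]n0.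
Qed.

(** The torsion class is extension-closed and contains the earlier terms; conversely, each induction
    step splits off a quotient lying in the term of index [j]. *)
Lemma alpha_span_before j : (j <= n.+1)%N ->
  ext_span (fun k : 'I_n.+1 => k < j)%N (alpha s) = (prolong j).1.
Proof.
move=> le_jn; apply: modclass_eq => [M|].
  apply; first exact: torsion_class_extension_closed hC (prolong_torsion_pair j).
  by move=> k lt_kj N; rewrite alphaE => -[_]; exact: prolong_torsion_mono.
elim: j le_jn => [_ M M0 D hD _|j IH lt_jn M TM D hD hsub].
  exact: zeroclass_sub M0.
have [A [B [f [g [sfg TA cB]]]]] := prolong_torsion_step TM.
have [_ _ D_ext] := hD; have fgM : fgmod M.
  by case: hC => -[C_fg _] _ _; exact/C_fg/(prolong_torsion_sub TM).
apply: (D_ext _ _ _ f g) => //.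
  by apply: (IH (ltnW lt_jn) A TA) => // k /ltnW; exact: hsub.
by apply: (hsub (Ordinal lt_jn)) => //; rewrite alphaE.
Qed.

Lemma alpha_span_after j : (j <= n.+1)%N ->
  ext_span (fun k : 'I_n.+1 => j <= k)%N (alpha s) = (prolong j).2.
Proof.
move=> le_jn; apply: modclass_eq => [M|].
  apply; first exact: torsionfree_class_extension_closed hC (prolong_torsion_pair j).
  by move=> k le_jk N; rewrite alphaE => -[+ _]; exact: prolong_torsionfree_anti.
(* Downward induction on [j], starting at [n.+1], where the torsion-free class is zero. *)
rewrite -(subKn le_jn); elim: (n.+1 - j)%N (leq_subr j n.+1) => [_|i IH lt_in].
  by rewrite subn0 prolong_last => M M0 D hD _; exact: zeroclass_sub M0.
have jE : (n.+1 - i = (n.+1 - i.+1).+1)%N by rewrite -subSn.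
move: (IH (ltnW lt_in)); rewrite jE; set m := (n.+1 - i.+1)%N.
have lt_mn : (m < n.+1)%N by rewrite /m ltn_subrL.
move=> {}IH M FM D hD hsub.
have [A [B [f [g [sfg cA FB]]]]] := prolong_torsionfree_step FM.
have [_ _ D_ext] := hD; have fgM : fgmod M.
  by case: hC => -[C_fg _] _ _; exact/C_fg/(prolong_torsionfree_sub FM).
apply: (D_ext _ _ _ f g) => //.
  by apply: (hsub (Ordinal lt_mn)) => //; rewrite alphaE.
by apply: (IH B FB) => // k /ltnW; exact: hsub.
Qed.

(** Once the closures are identified with prolonged classes, condition (2) at [j] is the prolonged
    pair [j.+1], and condition (1) is the orthogonality within [C] of the pairs [j] and [j.+1]. *)
Lemma alpha_n_torsion_pair : n_torsion_pair C (alpha s).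
Proof.
move=> j; have tp := prolong_torsion_pair.
rewrite (@alpha_span_before j.+1) // (@alpha_span_after j.+1) //.
rewrite (@alpha_span_before j) ?(ltnW (ltn_ord j)) // alphaE; split=> //.
  split; last by move=> M [_]; exact: prolong_torsion_sub.
  apply: interclass_extension_closed.
    exact: torsionfree_class_extension_closed hC (tp j).
  exact: torsion_class_extension_closed hC (tp j.+1).
rewrite (torsionfree_classE hC (tp j)) (torsion_classE hC (tp j.+1)).
by apply: modclass_eq => M [] => [[CM ?] [_ ?]|CM []].
Qed.

Lemma alphaK : beta (alpha s) = s.
Proof.
apply: functional_extensionality => i; have lt_in := ltn_ord i.
rewrite /beta (@alpha_span_before i.+1) ?ltnS ?(ltnW lt_in) //.
by rewrite (@alpha_span_after i.+1) ?ltnS ?(ltnW lt_in) // prolongS -surjective_pairing.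
Qed.

End Prolongation.

(** * From n-torsion pairs back to series *)

Lemma beta_torsion_pair_series C n (c : 'I_n.+1 -> modclass L) :
  n_torsion_pair C c -> torsion_pair_series C (beta c).
Proof.
move=> hc; split=> [i|i j le_ij].
  by have [_ _] := hc (widen_ord (leqnSn n) i).
by apply: ext_span_mono => k /leq_trans; exact.
Qed.

(** Condition (1) expresses the term at [j] by the closure before [j], found in [beta c] at [j - 1],
    and the closure after [j], found at [j]. At the two ends the missing closure is that of an empty
    family. *)
Lemma beta_inj C n (c c' : 'I_n.+1 -> modclass L) :
  n_torsion_pair C c -> n_torsion_pair C c' -> beta c = beta c' -> c = c'.
Proof.
move=> hc hc' e; apply: functional_extensionality => j.
have eT (i : 'I_n) := f_equal (fun s => (s i).1) e.
have eF (i : 'I_n) := f_equal (fun s => (s i).2) e.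
have [_ -> _] := hc j; have [_ -> _] := hc' j.
congr (interclass C (interclass (rperp _) (lperp _))).
  case: (unliftP ord0 j) => [i ->|->]; first by rewrite lift0; exact: eT.
  exact: eq_ext_span.
case: (unliftP ord_max j) => [i ->|->]; first by rewrite lift_max; exact: eF.
by apply: eq_ext_span => // i; rewrite ltnNge -ltnS ltn_ord.
Qed.

End Classes.

Theorem theorem2p11 (L : pzRingType) (hL : artin_algebra L)
    (C : modclass L) (hC : extension_closed C)
    (n : nat) (hn : (1 <= n)%N) :
  [/\ forall s : 'I_n -> modclass L * modclass L,
        torsion_pair_series C s -> n_torsion_pair C (alpha s),
      forall c : 'I_n.+1 -> modclass L,
        n_torsion_pair C c -> torsion_pair_series C (beta c),
      forall s : 'I_n -> modclass L * modclass L,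
        torsion_pair_series C s -> beta (alpha s) = s
    & forall c : 'I_n.+1 -> modclass L,
        n_torsion_pair C c -> alpha (beta c) = c].
Proof.
split=> [s hs|c|s hs|c hc]; first exact: alpha_n_torsion_pair.
- exact: beta_torsion_pair_series.
- exact: alphaK hC hs hn.
have hb := beta_torsion_pair_series hc.
(* Both sides have the same image under [beta], since [alphaK] applies to the series [beta c]. *)
apply: (beta_inj _ hc); first exact: alpha_n_torsion_pair.
exact: alphaK hC hb hn.
Qed.
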